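(* For each scale $S\subseteq[\mathbb{N}]^{\infty}$, the scale set $S\cup[\mathbb{N}]^{<\infty}$ (a subspace of the Cantor space $P(\mathbb{N})$) is productively hereditarily Lindelöf $\mathsf{U}_{\mathrm{fin}}(\mathrm{O},\Omega)$; that is, for every hereditarily Lindelöf Tychonoff space $Y$ satisfying $\mathsf{U}_{\mathrm{fin}}(\mathrm{O},\Omega)$, the product $(S\cup[\mathbb{N}]^{<\infty})\times Y$ is hereditarily Lindelöf and satisfies $\mathsf{U}_{\mathrm{fin}}(\mathrm{O},\Omega)$.
   Context: $P(\mathbb{N})$ is the power set of $\mathbb{N}$ with the topology of the Cantor space $\{0,1\}^{\mathbb{N}}$; $[\mathbb{N}]^{\infty}$ and $[\mathbb{N}]^{<\infty}$ are the families of infinite and of finite subsets of $\mathbb{N}$. For $a\in[\mathbb{N}]^\infty$, $a(n)$ is the $n$-th element in the increasing enumeration of $a$; $a\le^* b$ means $a(n)\le b(n)$ for all but finitely many $n$. $\mathfrak{b}$ is the minimal cardinality of a $\le^*$-unbounded subset of $[\mathbb{N}]^{\infty}$. A scale is a set $S=\{s_\alpha : \alpha<\mathfrak{b}\}\subseteq[\mathbb{N}]^{\infty}$ that is cofinal (dominating) in $([\mathbb{N}]^{\infty},\le^* )$ and such that $s_\alpha\le^* s_\beta$ whenever $\alpha<\beta$. A cover of a space $X$ is a family $\mathcal{U}$ of subsets of $X$ with $X=\bigcup\mathcal{U}$ and $X\notin\mathcal{U}$. $\mathrm{O}(X)$: open covers of $X$. $\Omega(X)$: those $\mathcal{U}\in\mathrm{O}(X)$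 such that each finite subset of $X$ is contained in some member of $\mathcal{U}$. $X$ satisfies $\mathsf{U}_{\mathrm{fin}}(\mathrm{O},\Omega)$ (Scheepers' property) if for each sequence $\mathcal{U}_n\in\mathrm{O}(X)$, $n\in\mathbb{N}$, none containing a finite subcover, there are finite $\mathcal{F}_n\subseteq\mathcal{U}_n$ with $\{\bigcup\mathcal{F}_n : n\in\mathbb{N}\}\in\Omega(X)$. *)

(* Defs.v *)
From mathcomp Require Import all_boot all_order all_algebra.
From mathcomp Require Import all_classical all_reals all_analysis.
From mathcomp Require Import wochoice.

Set Implicit Arguments.
Unset Strict Implicit.
Unset Printing Implicit Defensive.

Import Order.TTheory.

Local Open Scope classical_set_scope.
Local Open Scope card_scope.

(* P(N) is [cantor_space], a subset of N being given by its characteristic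
   function. *)
Definition elements (a : cantor_space) : set nat := [set n | a n].

Definition inf_subsets : set cantor_space :=
  [set a | infinite_set (elements a)].

Definition fin_subsets : set cantor_space :=
  [set a | finite_set (elements a)].

Definition is_enumeration (a : cantor_space) (e : nat -> nat) : Prop :=
  {homo e : m n / (m < n)%N} /\ range e = elements a.

(* Indices start at 0; the value is meaningful only for [inf_subsets a],
   see [enumerationP]. *)
Definition enumeration (a : cantor_space) : nat -> nat :=
  get [set e | is_enumeration a e].

Lemma enumerationP (a : cantor_space) :
  inf_subsets a -> is_enumeration a (enumeration a).
Proof.
move=> infa; suff [e eP] : exists e, is_enumeration a e.
  by rewrite /enumeration; apply: (@getPex _ [set e | is_enumeration a e]); exists e.
have ex m : exists k, (m <= k)%N && a k.
  apply: contrapT => nex; apply: infa.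
  apply: (sub_finite_set (B := `I_m)); last exact: finite_II.
  move=> k ak /=; rewrite ltnNge; apply/negP => mk.
  by apply: nex; exists k; rewrite mk.
pose nxt m := ex_minn (ex m).
have nxtP m : [/\ (m <= nxt m)%N, a (nxt m) &
    forall k, (m <= k)%N -> a k -> (nxt m <= k)%N].
  rewrite /nxt; case: ex_minnP => k /andP[mk ak] kmin; split=> // j mj aj.
  by apply: kmin; rewrite mj.
pose e := fix e n := if n is n'.+1 then nxt (e n').+1 else nxt 0%N.
have eS n : (e n < e n.+1)%N by have [] := nxtP (e n).+1.
have eI : {homo e : m n / (m < n)%N}.
  move=> m; elim=> // n IH; rewrite ltnS leq_eqVlt => /orP[/eqP->//|/IH mn].
  exact: ltn_trans mn (eS n).
have ege n : (n <= e n)%N.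
  by elim: n => // n IH; exact: leq_ltn_trans IH (eS n).
exists e; split=> //; apply/seteqP; split=> [_ [n _ <-]|k ak].
  by rewrite /elements /=; case: n => [|n]; [have [] := nxtP 0%N|have [] := nxtP (e n).+1].
have exn : exists n, (k <= e n)%N by exists k.
have [n kn nmin] := ex_minnP exn; exists n => //.
apply/eqP; rewrite eqn_leq kn andbT.
case: n kn nmin => [|n] kn nmin; first by have [_ _] := nxtP 0%N; apply.
have [_ _] := nxtP (e n).+1; apply=> //; rewrite ltnNge.
by apply/negP => /nmin; rewrite ltnn.
Qed.

Definition le_star (a b : cantor_space) : Prop :=
  \forall n \near \oo, (enumeration a n <= enumeration b n)%N.

Definition unbounded (B : set cantor_space) : Prop :=
  B `<=` inf_subsets /\
  ~ exists2 c, inf_subsets c & forall b, B b -> le_star b c.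

Definition dominating (D : set cantor_space) : Prop :=
  D `<=` inf_subsets /\
  forall a, inf_subsets a -> exists2 d, D d & le_star a d.

Definition card_is_b (I : Type) : Prop :=
  (exists2 B, unbounded B & [set: I] #= B) /\
  (forall B, unbounded B -> [set: I] #<= B).

(* [I] has the order type of an initial ordinal, i.e. of a cardinal. *)
Definition initial_ordinal d (I : orderType d) : Prop :=
  well_order (<=%O : rel I) /\
  forall j : I, ~ ([set: I] #<= [set i : I | (i < j)%O]).

(* The ordinal b, as an index set, is any [I] ordered in the type of the
   initial ordinal of cardinality b. *)
Definition is_scale (S : set cantor_space) : Prop :=
  exists (d : Order.disp_t) (I : orderType d) (s : I -> cantor_space),
    [/\ initial_ordinal I /\ card_is_b I,
        S = range s,
        dominating S &
        forall i j : I, (i < j)%O -> le_star (s i) (s j)].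

Definition is_cover (X : Type) (U : set (set X)) : Prop :=
  \bigcup_(V in U) V = [set: X] /\ ~ U [set: X].

Definition open_covers (X : topologicalType) : set (set (set X)) :=
  [set U | is_cover U /\ forall V, U V -> open V].
Arguments open_covers : clear implicits.

Definition omega_covers (X : topologicalType) : set (set (set X)) :=
  [set U | open_covers X U /\
    forall A : set X, finite_set A -> exists2 V, U V & A `<=` V].
Arguments omega_covers : clear implicits.

Definition subcover (X : Type) (F U : set (set X)) : Prop :=
  F `<=` U /\ \bigcup_(V in F) V = [set: X].

Definition Ufin_O_Omega (X : topologicalType) : Prop :=
  forall U : nat -> set (set X),
    (forall n, open_covers X (U n)) ->
    (forall n, ~ exists2 F, finite_set F & subcover F (U n)) ->
    exists F : nat -> set (set X),
      (forall n, finite_set (F n) /\ F n `<=` U n) /\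
      omega_covers X [set \bigcup_(V in F n) V | n in [set: nat]].

Definition lindelof (X : topologicalType) : Prop :=
  forall U, open_covers X U -> exists2 F, countable F & subcover F U.

(* [A : set X], used as a type, carries the subspace topology. *)
Definition hereditarily_lindelof (X : topologicalType) : Prop :=
  forall A : set X, lindelof A.

Definition tychonoff_space (X : topologicalType) : Prop :=
  completely_regular_space X /\ hausdorff_space X.

Definition productively_hL_Ufin_O_Omega (X : topologicalType) : Prop :=
  forall Y : topologicalType,
    tychonoff_space Y -> hereditarily_lindelof Y -> Ufin_O_Omega Y ->
    hereditarily_lindelof (X * Y)%type /\ Ufin_O_Omega (X * Y)%type.

(* Main.v *)
Require Import Defs.
From mathcomp Require Import all_boot all_order all_algebra.
From mathcomp Require Import all_classical all_reals all_analysis.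
From mathcomp Require Import wochoice.

(** Let X be the scale set, [E] below, and let [s] enumerate the scale.

The product X * Y is hereditarily Lindelöf because X is second countable and
Y is hereditarily Lindelöf: for each of the countably many cylinders C of X,
only countably many open V are needed to cover the union of those V for which
C * V lies in a member of a given open family ([countable_subunions_prod]).

For U_fin(O, Omega), let covers of X * Y be given. As X * Y is Lindelöf, the
n-th cover may be taken to be an increasing sequence V n m of unions of finite
parts of it, and the task is to find h such that every finite subset of X * Y
is contained in V n (h n) for some n.

Fix n and y. For each k there are only finitely many t contained in
{0, .., k-1}, and all of them are points of X. A member a of X that is disjoint
from [k, l) for a large l is close to one of these t, so that for some l > k
all (a, y) with a disjoint from [k, l) lie in V n l, and the same l works near
y ([tube]).
Iterating yields k_0 < .. < k_(n+1), a chain of n+1 consecutive gaps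
([gap_chain]). If the chain is bounded by m and m is at most the n-th element
of a, then a has at most n elements below m, hence misses one of the n+1
intervals, and (a, y) is in V n m ([gap_chain_infinite]). The pigeonhole
principle is applied to a and y separately, so the intervals may depend on y;
only the bound m has to be uniform. That is what makes the weak, finitary
form of domination in U_fin(O, Omega) sufficient.

Indeed, for a finite set A of indices, U_fin(O, Omega) for Y gives a function
g_A such that for every finite part of Y there are arbitrarily large n for
which g_A n bounds the chains of all its points, while V n (g_A n) also
contains all (s i, y) with i in A and y in that part
([Ufin_O_Omega_functions]). There is an index i0 such that s_i0 eventually
dominates g_A for every finite A of indices below i0 ([scale_reflection]). Then
h := s_i0 works: given finitely many points of X * Y, let A be the set of the
indices below i0 that occur in them. The points s_i with i >= i0
dominate s_i0, hence g_A, and are captured by the pigeonhole principle at all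
large n; so are the finite sets; and the s_i with i < i0 are captured by the
choice of g_A. *)

Set Implicit Arguments.
Unset Strict Implicit.
Unset Printing Implicit Defensive.

Import Order.TTheory.

Local Open Scope classical_set_scope.
Local Open Scope card_scope.

(** * Bounds along a scale *)

Lemma homo_ltn_ge (k : nat -> nat) : {homo k : m n / (m < n)%N} -> forall n, (n <= k n)%N.
Proof. by move=> kI; elim=> // n IH; exact: leq_ltn_trans IH (kI _ _ (ltnSn n)). Qed.

Lemma finite_nat_bounded (A : set nat) : finite_set A ->
  exists M, forall m, A m -> (m <= M)%N.
Proof.
move=> /finite_seqP[s ->]; exists (\max_(i <- s) i)%N => m ms.
exact: leq_bigmax_seq.
Qed.

(** Comparisons with enumerations of infinite sets, in terms of which
boundedness and domination are defined, are thereby comparisons with arbitrary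
functions. *)
Lemma exists_set_above (g : nat -> nat) :
  exists2 c, inf_subsets c & forall n, (g n <= enumeration c n)%N.
Proof.
pose G n := (\sum_(i < n.+1) (g i).+1)%N.
have GS n : (G n < G n.+1)%N by rewrite /G [ltnRHS]big_ord_recr /= -addSnnS leq_addr.
have GI : {homo G : m n / (m < n)%N} by apply: homo_ltn => //; exact: ltn_trans.
have gG n : (g n <= G n)%N by rewrite /G big_ord_recr /= -addSnnS leq_addl.
pose c : cantor_space := fun m => `[< range G m >].
have rangeG : elements c = range G.
  by apply/seteqP; split=> m; rewrite /elements /c /= => /asboolP.
have infc : inf_subsets c.
  rewrite /inf_subsets /= rangeG => /finite_nat_bounded[M MP].
  have /MP : range G (G M.+1) by exists M.+1.
  by rewrite leqNgt homo_ltn_ge.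
exists c => // n; have [eI re] := enumerationP infc.
(* The enumeration of [range G] is [G] along an increasing sequence of indices,
   so it is above [G] without having to be identified with it. *)
have preG m : exists k, G k = enumeration c m.
  have : range G (enumeration c m) by rewrite -rangeG -re; exists m.
  by case=> k _ <-; exists k.
have [k kP] := choice preG.
have kI : {homo k : m n / (m < n)%N}.
  move=> m p mp; rewrite ltnNge; apply/negP => kpm.
  have := eI _ _ mp; rewrite -!kP ltnNge => /negP; apply.
  have [->//|ne] := eqVneq (k p) (k m).
  by apply: ltnW; apply: GI; rewrite ltn_neqAle ne.
rewrite -kP (leq_trans (gG n)) //; have := homo_ltn_ge kI n.
by rewrite leq_eqVlt => /orP[/eqP <-//|/GI/ltnW].
Qed.

Section Scale.
Variables (d : Order.disp_t) (I : orderType d).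
Hypotheses (initI : initial_ordinal I) (cardI : card_is_b I).

(** A proper initial segment has cardinality less than b. *)
Lemma initial_segment_bounded (i : I) (K : I -> nat -> nat) :
  exists h, forall j, (j < i)%O -> \forall n \near \oo, (K j n <= h n)%N.
Proof.
have /choice[c cP] j : exists c, inf_subsets c /\
    forall n, (K j n <= enumeration c n)%N.
  by have [c] := exists_set_above (K j); exists c.
have [[h infh hP]|nb] := pselect (exists2 h, inf_subsets h &
    forall j, (j < i)%O -> le_star (c j) h).
  exists (enumeration h) => j ji; apply: filterS (hP j ji) => n.
  by apply: leq_trans; have [_] := cP j.
exfalso; apply: (initI.2 i); pose B := c @` [set j | (j < i)%O].
have unbB : unbounded B.
  split=> [_ [j _ <-]|[h infh hP]]; first by have [] := cP j.
  by apply: nb; exists h => // j ji; apply: hP; exists j.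
apply: card_le_trans (cardI.2 B unbB) _; exact: card_image_le.
Qed.

(** By induction on the length of the sequence, bounding one index at a time:
this avoids computing the cardinality of the family of finite subsets. *)
Lemma initial_segment_seq_bounded (i : I) (g : seq I -> nat -> nat) :
  exists h, forall A, {in A, forall j, (j < i)%O} ->
    \forall n \near \oo, (g A n <= h n)%N.
Proof.
have bnd p : exists h, forall A, size A = p -> {in A, forall j, (j < i)%O} ->
    \forall n \near \oo, (g A n <= h n)%N.
  elim: p g => [|p IH] g.
    by exists (g [::]) => -[]// _ _; exact: nearW.
  have [H HP] := choice (fun j => IH (fun A => g (j :: A))).
  have [h hP] := initial_segment_bounded i H.
  exists h => -[//|j A] [sA] lti.
  have jA : (j < i)%O by apply: lti; rewrite mem_head.
  have ltA : {in A, forall j, (j < i)%O}.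
    by move=> j' j'A; apply: lti; rewrite inE j'A orbT.
  apply: filterS2 (HP j A sA ltA) (hP j jA) => n; exact: leq_trans.
have [H HP] := choice bnd.
exists (fun n => \max_(p < n.+1) H p n) => A lti.
apply: filterS2 (HP _ A erefl lti) (nbhs_infty_ge (size A)) => n gH sn.
apply: leq_trans gH _.
exact: (leq_bigmax (F := fun p : 'I_n.+1 => H p n) (Ordinal (sn : size A < n.+1)%N)).
Qed.

Variable s : I -> cantor_space.
Hypotheses (doms : dominating (range s))
           (les : forall i j : I, (i < j)%O -> le_star (s i) (s j)).

Lemma scale_homo i j : (i <= j)%O -> le_star (s i) (s j).
Proof. by rewrite le_eqVlt => /orP[/eqP->|/les//]; exact: nearW. Qed.

Lemma scale_above (g : nat -> nat) :
  exists i, \forall n \near \oo, (g n <= enumeration (s i) n)%N.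
Proof.
have [c infc gc] := exists_set_above g.
have [_ [i _ <-] ci] := doms.2 c infc.
by exists i; apply: filterS ci => n; apply: leq_trans.
Qed.

(** The order has uncountable cofinality: otherwise some countable family of
members of the scale would be dominating, but it does not dominate the diagonal
maximum of their enumerations. *)
Lemma scale_countable_bounded (u : nat -> I) : exists i, forall j, (u j <= i)%O.
Proof.
have [i iP] := scale_above (fun n => \max_(j < n.+1) (enumeration (s (u j)) n).+1).
exists i => j; rewrite leNgt; apply/negP => iuj.
have [n [/= le1 le2 jn]] : exists n, [/\
   (\max_(j < n.+1) (enumeration (s (u j)) n).+1 <= enumeration (s i) n)%N,
   (enumeration (s i) n <= enumeration (s (u j)) n)%N & (j <= n)%N].
  apply: (@filter_ex _ \oo).
  by apply: filterS3 iP (les iuj) (nbhs_infty_ge j) => n.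
have := leq_trans le1 le2; apply/negP; rewrite -ltnNge.
exact: (leq_bigmax (F := fun j : 'I_n.+1 => (enumeration (s (u j)) n).+1)
  (Ordinal (jn : j < n.+1)%N)).
Qed.

(** A closing-off argument of length omega: along u_0 <= u_1 <= .., the member
of index u_(n+1) dominates all [g A] with [A] below u_n. A finite set below the
least upper bound of the u_n is already below some u_n, hence [g A] is
dominated by the member whose index is that least upper bound. *)
Lemma scale_reflection (g : seq I -> nat -> nat) :
  exists i, forall A, {in A, forall j, (j < i)%O} ->
    \forall n \near \oo, (g A n <= enumeration (s i) n)%N.
Proof.
have step i : exists j, (i <= j)%O /\ forall A, {in A, forall j, (j < i)%O} ->
    \forall n \near \oo, (g A n <= enumeration (s j) n)%N.
  have [h hP] := initial_segment_seq_bounded i g.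
  have [j hj] := scale_above h.
  exists (Order.max i j); split=> [|A /hP gh]; first by rewrite le_max lexx.
  have /scale_homo : (j <= Order.max i j)%O by rewrite le_max lexx orbT.
  by apply: filterS3 gh hj => n /leq_trans/[apply]/leq_trans; apply.
have [nxt nxtP] := choice step.
have [i0 _] := scale_above (fun=> 0%N).
pose u n := iter n nxt i0.
have uS n : (u n <= u n.+1)%O by have [] := nxtP (u n).
have uI m n : (m <= n)%N -> (u m <= u n)%O.
  by move=> mn; apply: (@homo_leq _ u <=%O) => //; exact: le_trans.
have [i' ui'] := scale_countable_bounded u.
have [i [[/asboolP ui imin] _]] : exists! i : I,
    minimum_of <=%O [pred i | `[< forall j, (u j <= i)%O >]] i.
  by apply: initI.1; exists i'; exact/asboolP.
exists i => A Ai.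
have [n un] : exists n, {in A, forall j, (j < u n)%O}.
  elim: A Ai => [|j A IH] Ai; first by exists 0%N.
  have [|n nP] := IH; first by move=> x xA; apply: Ai; rewrite inE xA orbT.
  have [m jm] : exists m, (j < u m)%O.
    apply: contrapT => nm; have : (j < i)%O by apply: Ai; rewrite mem_head.
    rewrite ltNge => /negP; apply; apply: imin; apply/asboolP => m.
    by rewrite leNgt; apply/negP => jm; apply: nm; exists m.
  exists (maxn m n) => x; rewrite inE => /orP[/eqP->|/nP xn].
    exact: lt_le_trans jm (uI _ _ (leq_maxl _ _)).
  exact: lt_le_trans xn (uI _ _ (leq_maxr _ _)).
have gA := (nxtP (u n)).2 A un.
by apply: filterS2 gA (scale_homo (ui n.+1)) => m; exact: leq_trans.
Qed.

End Scale.

(** * Hereditarily Lindelöf products *)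

(** The cylinders at [x] generate a filter, which converges to [x] because it
does so in each coordinate. *)
Lemma nbhs_cylinder (x : cantor_space) (U : set cantor_space) : nbhs x U ->
  exists l, forall a : cantor_space, (forall i, (i < l)%N -> a i = x i) -> U a.
Proof.
pose F : set_system cantor_space := [set A | exists l, forall a : cantor_space,
  (forall i, (i < l)%N -> a i = x i) -> A a].
have FF : Filter F.
  split; first by exists 0%N.
    move=> A B [l lA] [m mB]; exists (maxn l m) => a ax; split.
      by apply: lA => i il; apply: ax; rewrite leq_max il.
    by apply: mB => i il; apply: ax; rewrite leq_max il orbT.
  by move=> A B AB [l lA]; exists l => a /lA /AB.
suff Fx : F --> (x : cantor_space) by move/Fx.
apply/cvg_sup => i A [_ [[B Bop <-] Bx] BA].
by exists i.+1 => a ax; apply: BA; rewrite /= ax.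
Qed.

Lemma nbhs_subtype_cylinder (E : set cantor_space) (x : E) (U : set E) : nbhs x U ->
  exists l, forall a : E, (forall i, (i < l)%N -> val a i = val x i) -> U a.
Proof.
move=> [_ [[B Bop <-] /= Bx] BU].
have /nbhs_cylinder[l lB] : nbhs (val x : cantor_space) B by exact: open_nbhs_nbhs.
by exists l => a ax; apply: BU; exact: lB.
Qed.

(** The hereditary Lindelöf property, in terms of families of open sets of the
ambient space instead of open covers of subspaces. *)
Definition countable_subunions (Z : topologicalType) := forall U : set (set Z),
  (forall V, U V -> open V) ->
  exists2 F, countable F & F `<=` U /\ \bigcup_(V in U) V `<=` \bigcup_(V in F) V.

Lemma hereditarily_lindelof_subunions (Z : topologicalType) :
  hereditarily_lindelof Z -> countable_subunions Z.
Proof.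
move=> hLZ U Uop; pose D := \bigcup_(V in U) V.
(* Open covers exclude the whole space, so a family with a largest member is
   treated apart. *)
have [[V UV DV]|noV] := pselect (exists2 V, U V & D `<=` V).
  exists [set V]; first exact: countable1.
  by split=> [_ ->//|z /DV Vz]; exists V.
pose W : set (set D) := [set set_val @^-1` V | V in U].
have [|F Fc [FW FT]] := hLZ D W.
  split=> [|_ [V UV <-]]; last by exists V => //; exact: Uop.
  split=> [|[V UV VT]].
    apply/seteqP; split=> // z _; have [V UV Vz] := set_valP z.
    by exists (set_val @^-1` V) => //; exists V.
  apply: noV; exists V => // z Dz.
  have : [set: D] (SigSub (mem_set Dz)) by [].
  by rewrite -VT.
have /choice[r rP] w : exists V, F w -> U V /\ set_val @^-1` V = w.
  have [/FW[V UV <-]|nF] := pselect (F w); last by exists set0.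
  by exists V.
exists (r @` F); first exact: card_le_trans (card_image_le _ _) Fc.
split=> [_ [w /rP[Urw _] <-]//|z Dz].
have : [set: D] (SigSub (mem_set Dz)) by [].
rewrite -FT => -[w Fw wz]; exists (r w); first by exists w.
by move: wz; rewrite -{1}(rP w Fw).2.
Qed.

Lemma countable_subunions_lindelof (Z : topologicalType) :
  countable_subunions Z -> hereditarily_lindelof Z.
Proof.
move=> subZ A U [[UT _] Uop].
have /choice[r rP] w : exists V, U w -> open V /\ set_val @^-1` V = w.
  have [/Uop[V Vop Vw]|nU] := pselect (U w); last by exists set0.
  by exists V.
have [|F Fc [FW FT]] := subZ (r @` U); first by move=> _ [w /rP[? _] <-].
exists ((fun V => set_val @^-1` V) @` F).
  exact: card_le_trans (card_image_le _ _) Fc.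
split=> [_ [V /FW[w Uw <-] <-]|]; first by rewrite (rP w Uw).2.
apply/seteqP; split=> // z _.
have : [set: A] z by [].
rewrite -UT => -[w Uw wz].
have [|V FV Vz] := FT (set_val z).
  by exists (r w); [exists w|rewrite -(rP w Uw).2 in wz].
by exists (set_val @^-1` V) => //; exists V.
Qed.

(** Only the countable base of cylinders of [E] is used. An open box over a
cylinder that lies in a member of [U] may be replaced by one of countably many
such boxes over the same cylinder. *)
Lemma countable_subunions_prod (E : set cantor_space) (Y : topologicalType) :
  countable_subunions Y -> countable_subunions (E * Y)%type.
Proof.
move=> subY U Uop.
pose box (w : seq bool) (V : set Y) : set (E * Y) := [set p |
  (forall i, (i < size w)%N -> val p.1 i = nth false w i) /\ V p.2].
pose VV w := [set V : set Y | open V /\ exists2 u, U u & box w V `<=` u].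
have /choice[F FP] w : exists F, countable F /\ (F `<=` VV w /\
    \bigcup_(V in VV w) V `<=` \bigcup_(V in F) V).
  by apply/exists2P; apply: subY => V [].
have /choice[r rP] (wV : seq bool * set Y) : exists u, VV wV.1 wV.2 ->
    U u /\ box wV.1 wV.2 `<=` u.
  have [[_ [u Uu bu]]|nV] := pselect (VV wV.1 wV.2); last by exists set0.
  by exists u.
exists (\bigcup_(w in [set: seq bool]) ((fun V => r (w, V)) @` F w)).
  apply: bigcup_countable => [|w _]; first exact: countableP.
  by apply: card_le_trans (card_image_le _ _) _; have [] := FP w.
split=> [_ [w _ [V FwV <-]]|[a y] [u Uu uay]].
  by have [Fc [/(_ V FwV) VVwV _]] := FP w; have [] := rP (w, V) VVwV.
have [[/= A B] [/= Aa By] AB] : nbhs (a, y) u.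
  by apply: open_nbhs_nbhs; split=> //; exact: Uop.
have [l lA] := nbhs_subtype_cylinder Aa.
pose w := mkseq (val a) l.
have VB : VV w B°.
  split; first exact: open_interior.
  exists u => // -[b z] [/= ba Bz]; apply: AB; split=> /=.
    by apply: lA => i il; apply: etrans (ba i _) _; rewrite ?size_mkseq// nth_mkseq.
  exact: interior_subset Bz.
have [_ [FV /(_ y)]] := FP w; case.
  by exists B° => //; exact: nbhs_singleton (nbhs_interior By).
move=> V FwV Vy; exists (r (w, V)); first by exists w => //; exists V.
have [_] := rP (w, V) (FV _ FwV); apply; split => //= i.
by rewrite size_mkseq => il; rewrite nth_mkseq.
Qed.

(** * Scheepers' property and functions *)

Lemma near_seq (T : eqType) (P : nat -> T -> Prop) (ps : seq T) :
  {in ps, forall p, \forall n \near \oo, P n p} ->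
  \forall n \near \oo, {in ps, forall p, P n p}.
Proof.
elim: ps => [|p ps IH] nP; first exact: nearW.
have IHp : \forall n \near \oo, {in ps, forall p, P n p}.
  by apply: IH => q qps; apply: nP; rewrite inE qps orbT.
apply: filterS2 (nP p (mem_head _ _)) IHp => n Pp Pps q.
by rewrite inE => /orP[/eqP->//|/Pps].
Qed.

(** Scheepers' property in the language of functions. The capturing indices [n]
can be taken arbitrarily large, as the property also applies to the tails of
the sequence of covers. *)
Lemma Ufin_O_Omega_functions (Y : topologicalType) (O : nat -> nat -> set Y) :
  Ufin_O_Omega Y -> (forall n m, open (O n m)) ->
  (forall n, {homo O n : k m / (k <= m)%N >-> k `<=` m}) ->
  (forall n y, exists m, O n m y) ->
  exists g, forall A, finite_set A -> forall N, exists2 n, (N <= n)%N & A `<=` O n (g n).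
Proof.
move=> UY Oop OI OT.
have fin_range n (F : set (set Y)) : finite_set F -> F `<=` range (O n) ->
    exists m, \bigcup_(V in F) V `<=` O n m.
  move=> Ffin FO.
  have /choice[r rP] V : exists m, F V -> V = O n m.
    have [/FO[m _ <-]|nF] := pselect (F V); last by exists 0%N.
    by exists m.
  have [M MP] := finite_nat_bounded (finite_image r Ffin).
  exists M => y [V FV]; rewrite [V]rP//; apply: OI; apply: MP.
  by exists V.
have tail N : exists g, forall A, finite_set A ->
    exists2 n, (N <= n)%N & A `<=` O n (g n).
  (* The selection principle speaks only of covers without finite subcovers; if
     some cover of the tail has one, it captures everything. *)
  have [[n [m [Nn OnT]]]|noT] := pselect (exists n m, (N <= n)%N /\ O n m = setT).
    by exists (fun=> m) => A _; exists n => //; rewrite OnT.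
  have [n|n [F Ffin [FO FT]]|F [FP [_ FO]]] := UY (fun n => range (O (N + n)%N)).
  - split; last by move=> _ [m _ <-].
    split; last by move=> [m _ OT']; apply: noT; exists (N + n)%N, m; rewrite leq_addr.
    apply/seteqP; split=> // y _; have [m] := OT (N + n)%N y.
    by exists (O (N + n)%N m) => //; exists m.
  - have [m Fm] := fin_range _ _ Ffin FO; apply: noT; exists (N + n)%N, m.
    by rewrite leq_addr; split=> //; apply/seteqP; split=> //; rewrite -FT.
  - have /choice[r rP] n : exists m, \bigcup_(V in F n) V `<=` O (N + n)%N m.
      by apply: fin_range; have [] := FP n.
    exists (fun n => r (n - N)%N) => A /FO[_ [n _ <-] AF].
    exists (N + n)%N; first exact: leq_addr.
    by rewrite addKn; apply: subset_trans AF _.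
have [G GP] := choice tail.
exists (fun n => \max_(N < n.+1) G N n) => A Afin N.
have [n Nn AO] := GP N A Afin; exists n => //; apply: subset_trans AO _; apply: OI.
exact: (leq_bigmax (F := fun N : 'I_n.+1 => G N n) (Ordinal (Nn : N < n.+1)%N)).
Qed.

(** * Pigeonhole principle for gaps *)

Section GapChains.
Variables (E : set cantor_space) (Y : topologicalType) (V : nat -> set (E * Y)).
Hypotheses (finE : fin_subsets `<=` E)
  (Vopen : forall m, open (V m))
  (Vhomo : {homo V : k m / (k <= m)%N >-> k `<=` m})
  (Vcover : forall p, exists m, V m p).

Definition misses (a : E) (k l : nat) := forall i, (k <= i < l)%N -> val a i = false.

(** A tube lemma for the compact set of those [a] that miss all numbers from
[k] on; it is finite and contained in [E]. *)
Lemma tube (y : Y) k : exists l, (k < l)%N /\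
  \forall y' \near y, forall a, misses a k l -> V l (a, y').
Proof.
have cyl (t : k.-tuple bool) : exists l, \forall y' \near y, forall a : E,
    (forall i, (i < l)%N -> val a i = nth false t i) -> V l (a, y').
  pose x : cantor_space := nth false t.
  have Ex : E x.
    apply: finE; apply: (sub_finite_set (B := `I_k)); last exact: finite_II.
    move=> i; rewrite /elements /= => xi; rewrite ltnNge; apply/negP => ki.
    by move: xi; rewrite /x nth_default ?size_tuple.
  pose xE : E := SigSub (mem_set Ex).
  have [m Vm] := Vcover (xE, y).
  have [[/= A B] [/= Ax By] AB] : nbhs (xE, y) (V m) by apply: open_nbhs_nbhs; split.
  have [l lA] := nbhs_subtype_cylinder Ax.
  exists (maxn l m); apply: filterS By => y' By' a ax.
  apply: (Vhomo (leq_maxr l m)); apply: AB; split=> //=.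
  by apply: lA => i il; apply: etrans (ax i _) _ => //; rewrite leq_max il.
have [r rP] := choice cyl.
pose l := maxn k.+1 (\max_t r t).
exists l; split; first exact: leq_maxl.
have near_r : \forall y' \near y, forall (t : k.-tuple bool) (a : E),
    (forall i, (i < r t)%N -> val a i = nth false t i) -> V (r t) (a, y').
  exact: filter_forall.
apply: filterS near_r => y' rl a al.
have sz : size (mkseq (val a) k) == k by rewrite size_mkseq.
have rtl : (r (Tuple sz) <= l)%N by rewrite /l leq_max leq_bigmax orbT.
apply: (Vhomo rtl); apply: rl => i ir /=.
have [ik|ki] := ltnP i k; first by rewrite nth_mkseq.
by rewrite nth_default ?size_mkseq// al// ki (leq_trans ir).
Qed.

(** A chain of [n.+1] consecutive intervals, bounded by [m], such that [V m]
contains [(a, y)] as soon as [a] misses one of them. The intervals may depend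
on [y]. *)
Definition gap_chain (n m : nat) (y : Y) := exists2 k : nat -> nat, (k n.+1 <= m)%N &
  forall j, (j <= n)%N -> (k j < k j.+1)%N /\
    forall a, misses a (k j) (k j.+1) -> V m (a, y).

Lemma near_gap_chain n (y : Y) : exists m, \forall y' \near y, gap_chain n m y'.
Proof.
have [nxt nxtP] := choice (tube y).
pose k j := iter j nxt 0%N.
have kS j : (k j < k j.+1)%N by have [] := nxtP (k j).
have kI : {homo k : i j / (i <= j)%N}.
  by apply: homo_leq => //; [exact: leq_trans|move=> j; exact: ltnW].
have near_k : \forall y' \near y, forall j : 'I_n.+1, forall a,
    misses a (k j) (k j.+1) -> V (k j.+1) (a, y').
  by apply: filter_forall => j; have [] := nxtP (k j).
exists (k n.+1); apply: filterS near_k => y' y'P; exists k => // j jn; split=> // a aj.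
apply: (Vhomo (kI j.+1 n.+1 _)) => //.
exact: (y'P (Ordinal (jn : j < n.+1)%N)).
Qed.

(** If [a] met all intervals of the chain, its [n]-th element would be less than
the end of the last one, hence less than [m]. *)
Lemma gap_chain_infinite n m y a : inf_subsets (val a) -> gap_chain n m y ->
  (m <= enumeration (val a) n)%N -> V m (a, y).
Proof.
move=> infa [k km kP] ma; have [eI re] := enumerationP infa.
set e := enumeration _ in ma eI re.
apply: contrapT => nV.
have hit j : (j <= n)%N -> exists2 i, (k j <= e i)%N & (e i < k j.+1)%N.
  move=> jn; have [_ /(_ a) kV] := kP j jn.
  have /existsNP[i] : ~ misses a (k j) (k j.+1) by move=> /kV.
  move=> /not_implyP[/andP[ki ik]] /eqP; rewrite eqbF_neg negbK => ai.
  have : elements (val a) i by [].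
  by rewrite -re => -[i' _ ei]; exists i'; rewrite ei.
have below j : (j <= n)%N -> (e j < k j.+1)%N.
  elim: j => [|j IH] jn; have [i ki ik] := hit _ jn.
    apply: leq_ltn_trans ik; case: i {ki} => // i; exact/ltnW/eI.
  have : (e j < e i)%N by apply: leq_trans ki; exact/IH/ltnW.
  case: (ltnP j i) => [|ij]; last first.
    rewrite ltnNge; move: ij.
    by rewrite leq_eqVlt => /orP[/eqP->|/eI/ltnW->]; rewrite ?leqnn.
  rewrite leq_eqVlt => /orP[/eqP ji _|/eI ji _]; first by rewrite [in e _]ji.
  exact: ltn_trans ji ik.
by have := below n (leqnn n); rewrite ltnNge (leq_trans km).
Qed.

(** The last interval of the chain starts at [n] or later. *)
Lemma gap_chain_finite n m y a : (forall i, (n <= i)%N -> val a i = false) ->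
  gap_chain n m y -> V m (a, y).
Proof.
move=> an [k km kP]; have [_] := kP n (leqnn n); apply=> i /andP[ki _].
apply: an; apply: leq_trans ki.
suff: forall j, (j <= n)%N -> (j <= k j)%N by apply.
elim=> // j IH jn; have [kj _] := kP j (ltnW jn).
by apply: leq_ltn_trans (IH (ltnW jn)) kj.
Qed.

End GapChains.

(** * Products with a scale set *)

(** Number a countable subcover and let the [m]-th part consist of its members
with numbers up to [m]. *)
Lemma countable_exhaustion (Z : topologicalType) (U : set (set Z)) :
  countable_subunions Z -> open_covers Z U ->
  exists F : nat -> set (set Z), [/\ forall m, finite_set (F m) /\ F m `<=` U,
    {homo F : k m / (k <= m)%N >-> k `<=` m} &
    forall z, exists m, (\bigcup_(V in F m) V) z].
Proof.
move=> subZ [[UT _] Uop]; have [C Cc [CU UC]] := subZ U Uop.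
have /countable_injP[f finj] := Cc.
exists (fun m => [set V | C V /\ (f V <= m)%N]); split=> [m|k m km V [CV fV]|z].
- split; last by move=> V [/CU].
  have /choice[r rP] k : exists W, forall V, C V -> f V = k -> W = V.
    have [[V CV fV]|nV] := pselect (exists2 V, C V & f V = k).
      by exists V => W CW fW; apply: finj; rewrite ?fW//; exact/mem_set.
    by exists set0 => V CV fV; case: nV; exists V.
  apply: (sub_finite_set (B := r @` `I_m.+1)); last exact/finite_image/finite_II.
  by move=> V [CV fV]; exists (f V) => //; exact: rP.
- by split=> //; exact: leq_trans km.
- have : [set: Z] z by [].
  by rewrite -UT => /UC[V CV Vz]; exists (f V); exists V.
Qed.

Section ScaleProduct.
Variables (d : Order.disp_t) (I : orderType d) (s : I -> cantor_space).
Hypotheses (initI : initial_ordinal I) (cardI : card_is_b I)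
  (doms : dominating (range s))
  (les : forall i j : I, (i < j)%O -> le_star (s i) (s j)).
Let E := range s `|` fin_subsets.
Variable Y : topologicalType.

Let point_of i : E := SigSub (mem_set (or_introl (imageT s i) : E (s i))).

(** The index [i0] splits the scale: the finite set [A] of small indices is
provided for by the choice of [g A], and all other points of [E] are captured
by the pigeonhole principle at all large [n]. *)
Lemma scale_product_Ufin :
  countable_subunions Y -> Ufin_O_Omega Y -> Ufin_O_Omega (E * Y)%type.
Proof.
move=> subY UY U Ucov nofin.
have subEY := countable_subunions_prod (E := E) subY.
have /choice[F FP] n := countable_exhaustion subEY (Ucov n).
pose V n m : set (E * Y) := \bigcup_(W in F n m) W.
have Vop n m : open (V n m).
  apply: bigcup_open => W FW; have [/(_ m)[_ FU] _ _] := FP n.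
  by have [_] := Ucov n; apply; exact: FU.
have VI n : {homo V n : k m / (k <= m)%N >-> k `<=` m}.
  by move=> k m km z [W FW Wz]; exists W => //; have [_ /(_ k m km) + _] := FP n; apply.
have VT n p : exists m, V n m p by have [_ _] := FP n; apply.
have finE : fin_subsets `<=` E by move=> a; right.
pose P (A : seq I) n m : set Y := [set y | gap_chain (V n) n m y /\
  {in A, forall i, V n m (point_of i, y)}].
have PI A n : {homo P A n : k m / (k <= m)%N >-> k `<=` m}.
  move=> k m km y [[c ck cP] yA]; split; last by move=> i /yA; exact: VI.
  exists c; first exact: leq_trans km.
  by move=> j /cP[cj cV]; split=> // a /cV; exact: VI.
have nearP A n (y : Y) : exists m, \forall y' \near y, P A n m y'.
  elim: A => [|i A [m mP]].
    have [m mP] := near_gap_chain finE (Vop n) (VI n) (VT n) n y.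
    by exists m; apply: filterS mP.
  have [m' Vm'] := VT n (point_of i, y).
  have [[/= B C] [/= Bi Cy] BC] : nbhs (point_of i, y) (V n m').
    by apply: open_nbhs_nbhs; split.
  exists (maxn m m').
  apply: filterS2 mP Cy => y' /(PI A n _ _ (leq_maxl m m'))[gy Ay] Cy'.
  split=> // i'; rewrite inE => /orP[/eqP->|/Ay//].
  apply: (VI n _ _ (leq_maxr m m')); apply: BC; split=> //=.
  exact: nbhs_singleton.
have /choice[g gP] A : exists g, forall B, finite_set B ->
    forall N, exists2 n, (N <= n)%N & B `<=` (P A n (g n))°.
  apply: (@Ufin_O_Omega_functions _ (fun n m => (P A n m)°)) => // [n m|n k m km|n y].
  - exact: open_interior.
  - exact/interiorS/PI.
  - exact: nearP.
have [i0 i0P] := scale_reflection initI cardI doms les g.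
pose h := enumeration (s i0).
have capture (B : set (E * Y)) : finite_set B -> exists n, B `<=` V n (h n).
  move=> /[dup] Bfin /finite_seqP[ps Bps].
  (* Points captured at all large [n], whatever the small indices are. *)
  pose large (p : E * Y) := forall A, {in A, forall j, (j < i0)%O} ->
    \forall n \near \oo, forall y, gap_chain (V n) n (g A n) y -> V n (g A n) (p.1, y).
  have small_or_large p : (exists2 i, (i < i0)%O & p.1 = point_of i) \/ large p.
    case: p => a y0; rewrite /large /=.
    have [[i _ ia]|fa] := set_valP a; last first.
      right=> A _; have [M MP] := finite_nat_bounded fa.
      apply: filterS (nbhs_infty_ge M.+1) => n Mn y.
      apply: gap_chain_finite => i ni; apply/negP => /MP.
      by rewrite leqNgt (leq_trans Mn ni).
    have [ii0|i0i] := ltP i i0.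
      by left; exists i => //; apply: val_inj.
    right=> A Ai0; apply: filterS2 (i0P A Ai0) (scale_homo les i0i) => n gi0 i0n y.
    move=> gy; apply: gap_chain_infinite gy _.
      by apply: doms.1; rewrite -ia; exists i.
    by rewrite -ia; exact: leq_trans gi0 i0n.
  have [A [Ai0 Acov]] : exists A : seq I, {in A, forall j, (j < i0)%O} /\
      {in ps, forall p, (exists2 i, i \in A & p.1 = point_of i) \/ large p}.
    elim: {Bps} ps => [|p ps [A [Ai0 Acov]]]; first by exists [::].
    have [[i ii0 pi]|lp] := small_or_large p.
      exists (i :: A); split=> [j|q]; rewrite inE => /orP[/eqP->//|].
      - exact: Ai0.
      - by left; exists i => //; rewrite mem_head.
      - move=> /Acov[[j jA qj]|]; [left|by right].
        by exists j => //; rewrite inE jA orbT.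
    exists A; split=> // q; rewrite inE => /orP[/eqP->|/Acov//].
    by right.
  have /near_seq goodn : {in ps, forall p, \forall n \near \oo,
      (exists2 i, i \in A & p.1 = point_of i) \/
      forall y, gap_chain (V n) n (g A n) y -> V n (g A n) (p.1, y)}.
    move=> p /Acov[pA|/(_ A Ai0)]; first by apply: nearW => n; left.
    by apply: filterS => n; right.
  have [N _ NP] := filterI goodn (i0P A Ai0).
  have [n /NP[good_n gh] Bn] := gP A (snd @` B) (finite_image _ Bfin) N.
  exists n => -[a y] Bay; apply: (VI n _ _ gh).
  have /interior_subset[gy Ay] : (P A n (g A n))° y by apply: Bn; exists (a, y).
  have : (a, y) \in ps by move: Bay; rewrite Bps.
  by case/good_n => /= [[i /Ay + ->]|]; last exact.
(* No member of the selection is the whole space, since no cover has a finite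
   subcover; being a cover is the case of singletons of [capture]. *)
exists (fun n => F n (h n)); split; first by move=> n; have [] := FP n.
have Vcov B : finite_set B -> exists2 W, [set V n (h n) | n in [set: nat]] W & B `<=` W.
  by move=> /capture[n Bn]; exists (V n (h n)) => //; exists n.
split=> //; split; last by move=> _ [n _ <-]; exact: Vop.
split.
  apply/seteqP; split=> // z _; have [W VW zW] := Vcov [set z] (finite_set1 z).
  by exists W => //; apply: zW.
move=> [n _ VnT]; apply: (nofin n).
by exists (F n (h n)); have [/(_ (h n))[Ffin FU] _ _] := FP n.
Qed.

End ScaleProduct.

Theorem theorem6p7 (S : set cantor_space) (hS : is_scale S) :
  productively_hL_Ufin_O_Omega (set_type (S `|` fin_subsets)).
Proof.
have [d [I [s [[initI cardI] -> doms les]]]] := hS.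
move=> Y _ /hereditarily_lindelof_subunions subY UY; split.
  exact/countable_subunions_lindelof/countable_subunions_prod.
exact: scale_product_Ufin.
Qed.
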